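(* Let $\Phi_{\mathrm{hyp}}(s,z,\xi)=z\cdot\xi+s\xi_1\xi_2$ for $y=(s,z)\in\mathbb R\times\mathbb R^2$, $\xi\in\mathbb R^2$, and let $b\in C_0^\infty(\mathbb R\times\mathbb R^2\times\mathbb R^2)$ be equal to one for $0\le s\le1$, $|z|\le c_0$, $|\xi|\le c_0$, with $c_0>0$ small. Define $$T_{\nu,\Phi_{\mathrm{hyp}}}h(y)=\nu\int_{\mathbb R^2}e^{i\nu\Phi_{\mathrm{hyp}}(y,\xi)}b(y,\xi)h(\xi)\,d\xi.$$ Then, for every large $\lambda$, with $\mu=\lambda^2$, there are functions $f_\lambda,g_\mu$ with $\|f_\lambda\|_{L^2(\mathbb R^2)}=\|g_\mu\|_{L^2(\mathbb R^2)}=1$ such that $$\|T_{\lambda,\Phi_{\mathrm{hyp}}}f_\lambda\;T_{\mu,\Phi_{\mathrm{hyp}}}g_\mu\|_{L^2(\mathbb R^3)}\gtrsim\lambda^{1/2}\sqrt{\log\lambda}.$$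
   Context: $X\gtrsim Y$ means $X\ge cY$ with a constant $c>0$ independent of $\lambda$. *)

(* Defs.v *)
From HB Require Import structures.
From mathcomp Require Import all_boot all_order all_algebra.
From mathcomp Require Import complex.
From mathcomp Require Import all_classical all_reals all_analysis.
Set Implicit Arguments.
Unset Strict Implicit.
Unset Printing Implicit Defensive.
Import Order.TTheory GRing.Theory Num.Theory.
Import numFieldNormedType.Exports.
Local Open Scope classical_set_scope.
Local Open Scope complex_scope.
Local Open Scope ring_scope.

Notation "'plane' R" := (R * R)%type (at level 10, R at level 9).
Notation "'spacetime' R" := (R * (R * R))%type (at level 10, R at level 9).

(* The library's sigma-finiteness instance for \x is shadowed by the one for
   probabilities, hence the named constants with their own instances. *)
Section Lebesgue.
Variable R : realType.

Definition leb2 : set (measurableTypeR R * measurableTypeR R) -> \bar R :=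
  (@lebesgue_measure R \x @lebesgue_measure R)%E.

HB.instance Definition _ := Measure.on leb2.

Lemma leb2_sigma_finite : sigma_finite [set: _] leb2.
Proof.
have /sigma_finiteP[F [TF ndF Foo]] := sigma_finiteT (@lebesgue_measure R).
exists (fun n => F n `*` F n).
  rewrite -setXTT TF predeqE => -[x y]; split.
    move=> [/= [n _ Fnx] [k _ Fky]]; exists (maxn n k) => //; split.
    - by move: x Fnx; exact/subsetPset/ndF/leq_maxl.
    - by move: y Fky; exact/subsetPset/ndF/leq_maxr.
  by move=> [n _ []/= ? ?]; split; exists n.
move=> k; have [? ?] := Foo k.
split; first exact: measurableX.
by rewrite /leb2 product_measure1E// lte_mul_pinfty// ge0_fin_numE.
Qed.

HB.instance Definition _ :=
  Measure_isSigmaFinite.Build _ _ _ leb2 leb2_sigma_finite.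

Definition leb3 :
    set (measurableTypeR R * (measurableTypeR R * measurableTypeR R)) ->
    \bar R :=
  (@lebesgue_measure R \x leb2)%E.

HB.instance Definition _ := Measure.on leb3.

End Lebesgue.
Arguments leb2 R : clear implicits.
Arguments leb3 R : clear implicits.

Section Definitions.
Variable R : realType.

Definition dot (x w : plane R) : R := x.1 * w.1 + x.2 * w.2.

(* The norm of the product type R * R is the max norm, hence this one. *)
Definition enorm (x : plane R) : R := Num.sqrt (dot x x).

Definition cmeasurable d (T : measurableType d) (f : T -> R[i]) : Prop :=
  measurable_fun [set: T] (fun x => complex.Re (f x)) /\
  measurable_fun [set: T] (fun x => complex.Im (f x)).

Definition L2norm d (T : measurableType d) (m : {measure set T -> \bar R})
    (f : T -> R[i]) : \bar R :=
  Lnorm m 2%:E (fun x => (ComplexField.Normc.normc (f x))%:E).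

(* C^n regularity through iterated directional derivatives; in the finite
   dimensional spaces where it is used, this is the usual notion (all partial
   derivatives up to order n exist and are continuous). *)
Fixpoint Cn (V : normedModType R) (n : nat) (f : V -> R) : Prop :=
  match n with
  | 0 => continuous f
  | m.+1 => forall v : V,
      (forall x, derivable f x v) /\ Cn m (fun x => 'D_v f x)
  end.

Definition smooth (V : normedModType R) (f : V -> R) : Prop :=
  forall n, Cn n f.

Definition test_function (V : normedModType R) (b : V -> R[i]) : Prop :=
  [/\ smooth (fun x => complex.Re (b x)),
      smooth (fun x => complex.Im (b x)) &
      compact (closure [set x | b x <> 0])].

Definition cis (t : R) : R[i] := cos t +i* sin t.

Definition cintegral d (T : measurableType d) (m : {measure set T -> \bar R})
    (f : T -> R[i]) : R[i] :=
  (\int[m]_x complex.Re (f x)) +i* (\int[m]_x complex.Im (f x)).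

Definition Phi_hyp (y : spacetime R) (xi : plane R) : R :=
  dot y.2 xi + y.1 * xi.1 * xi.2.

Definition T_op (Phi : spacetime R -> plane R -> R)
    (b : spacetime R * plane R -> R[i]) (nu : R) (h : plane R -> R[i])
    (y : spacetime R) : R[i] :=
  nu%:C *
  cintegral (leb2 R) (fun xi => cis (nu * Phi y xi) * b (y, xi) * h xi).

End Definitions.

(* Main.v *)
Require Import Defs.
From mathcomp Require Import all_boot all_order all_algebra.
From mathcomp Require Import complex.
From mathcomp Require Import all_classical all_reals all_analysis.
From mathcomp Require Import measurable_realfun ring lra.
Import Order.TTheory GRing.Theory Num.Theory.
Import numFieldNormedType.Exports.
Local Open Scope ring_scope.
Set Implicit Arguments.
Unset Strict Implicit.

(** No oscillation is needed. Put [a = c0 / 2] and [r = a / lambda], let [E] be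
    the hyperbolic region [1 / lambda <= x <= a], [y >= 0], [x y <= r], whose
    area [r ln (a lambda)] carries the logarithm, and let [Q] be the square
    [0, r] x [0, r]. Take [f] and [g] to be the L2-normalised indicators of [E]
    and [Q]. For [s] in [0, 1] and [z] in [Q] the phases [lambda Phi] on [E] and
    [lambda ^ 2 Phi] on [Q] stay in [0, 1], so the real parts of the two
    integrals are at least [cos 1] times the square roots of the areas. Hence
    the product is at least a constant times
    [lambda (area E)^(1/2) * lambda ^ 2 r] on the prism [0, 1] x [Q], which has
    volume [r ^ 2]. *)

(** * L2 norms: lower bounds and normalised indicators *)

Section L2.
Import HBNNSimple.
Context d (T : measurableType d) (R : realType).
Variable m : {measure set T -> \bar R}.
Implicit Types (A : set T) (f : T -> R[i]).

(* Directly from [\int] as a supremum over simple functions: [ge0_le_integral]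
   would ask for the measurability of [T_op] in [y]. *)
Lemma ge0_integral_ge_cst_on A (K : R) (f : T -> \bar R) :
  measurable A -> 0 <= K -> (forall x, (0 <= f x)%E) ->
  (forall x, A x -> (K%:E <= f x)%E) -> (K%:E * m A <= \int[m]_x f x)%E.
Proof.
move=> mA K0 f0 Kf; rewrite ge0_integralTE//.
rewrite -(sintegral_EFin_cst m A (NngNum K0)).
pose h := mul_nnsfun (cst_nnsfun T (NngNum K0)) (indic_nnsfun R mA).
have -> : (cst (NngNum K0)%:num \_ A)%classic = h.
  apply/funext => x /=; rewrite patchE mindicE; case: ifPn => _.
    by rewrite mulr1.
  by rewrite mulr0.
apply: ereal_sup_ubound; exists h => //.
move=> x /=; rewrite mindicE; have [/set_mem Ax|_] := boolP (x \in A).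
  by rewrite mulr1; exact: Kf.
by rewrite mulr0 f0.
Qed.

Lemma L2normE f :
  L2norm m f =
    ((\int[m]_x ((ComplexField.Normc.normc (f x)) ^+ 2)%:E) `^ 2^-1)%E.
Proof.
rewrite /L2norm unlock; congr poweR; apply: eq_integral => x _ /=.
have n0 : 0 <= ComplexField.Normc.normc (f x).
  by case: (f x) => u v; rewrite sqrtr_ge0.
by rewrite ger0_norm// powR_mulrn.
Qed.

(** Keeping only [A] in the integral of the squared modulus leaves at least [K ^ 2 * M]; then take
    square roots. *)
Lemma L2norm_ge_cst_on A (M K : R) f :
  measurable A -> m A = M%:E -> 0 <= K ->
  (forall x, A x -> K <= ComplexField.Normc.normc (f x)) ->
  ((K * Num.sqrt M)%:E <= L2norm m f)%E.
Proof.
move=> mA mAM K0 Kf; rewrite L2normE.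
have M0 : 0 <= M by rewrite -lee_fin -mAM.
have -> : (K * Num.sqrt M)%:E = (((K ^+ 2)%:E * M%:E) `^ 2^-1)%E.
  rewrite -EFinM poweR12_sqrt/= ?lee_fin ?mulr_ge0 ?sqr_ge0//.
  by rewrite sqrtrM ?sqr_ge0// sqrtr_sqr ger0_norm.
have I0 : (0 <= \int[m]_x ((ComplexField.Normc.normc (f x)) ^+ 2)%:E)%E.
  by apply: integral_ge0 => x _; rewrite lee_fin sqr_ge0.
apply: gt0_ler_poweR; rewrite ?in_itv/= ?andbT ?leey// ?invr_ge0//.
  by rewrite -EFinM lee_fin mulr_ge0 ?sqr_ge0.
  by rewrite I0.
rewrite -mAM; apply: ge0_integral_ge_cst_on => //.
- exact: sqr_ge0.
- by move=> x; rewrite lee_fin sqr_ge0.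
- by move=> x Ax; rewrite lee_fin lerXn2r ?nnegrE ?(le_trans K0) ?Kf.
Qed.

(** [M] stands for the measure of [A], passed as a real number to keep the normalising factor an
    ordinary square root. *)
Definition unit_indic (M : R) A : T -> R[i] :=
  fun x => ((Num.sqrt M)^-1 * \1_A x)%:C%C.

Lemma cmeasurable_unit_indic M A :
  measurable A -> cmeasurable (unit_indic M A).
Proof.
move=> mA; split; last exact: measurable_cst.
by apply: measurable_funM; [exact: measurable_cst|exact: measurable_indic].
Qed.

Lemma L2norm_unit_indic (M : R) A :
  measurable A -> m A = M%:E -> 0 < M -> L2norm m (unit_indic M A) = 1%E.
Proof.
move=> mA mAM M0; rewrite L2normE.
under eq_integral => x _.
  have -> : (ComplexField.Normc.normc (unit_indic M A x)) ^+ 2 = M^-1 * \1_A x.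
    rewrite /= expr0n addr0 sqr_sqrtr ?sqr_ge0// exprMn exprVn.
    rewrite sqr_sqrtr ?(ltW M0)// indicE; congr (_ * _).
    by case: (x \in A); rewrite ?expr1n ?expr0n.
  rewrite EFinM; over.
rewrite ge0_integralZl//=.
- rewrite integral_indic// setIT mAM -EFinM mulVf ?gt_eqF// poweR1r//.
- by apply/measurable_EFinP; exact: measurable_indic.
- by rewrite lee_fin invr_ge0 ltW.
Qed.

End L2.

(** * Lower bound for the operator when the phase stays small *)

Section lower_bounds.
Variable R : realType.

(** Cosine decreases on [[0, pi]], which contains [[0, 1]]. *)
Lemma cos1_le_cos (t : R) : 0 <= t <= 1 -> cos 1 <= cos t.
Proof.
move=> /andP[t0 t1]; have pi1 : 1 <= pi :> R.
  by rewrite (le_trans _ (pi_ge2 R))// ler1n.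
by rewrite leNgt ltr_cos ?in_itv/= ?t0 ?ler01 ?(le_trans t1)// -leNgt.
Qed.

Lemma measurable_Phi_hyp (y : spacetime R) :
  measurable_fun [set: measurableTypeR R * measurableTypeR R]
    (fun xi => Phi_hyp y xi : measurableTypeR R).
Proof.
rewrite /Phi_hyp /dot.
apply: measurable_funD; last apply: measurable_funM.
- by apply: measurable_funD; apply: measurable_funM => //.
- by apply: measurable_funM.
- exact: measurable_snd.
Qed.

(* As the phase stays in [0, 1] there is no cancellation on [A]. *)
Lemma T_op_unit_indic_ge (b : spacetime R * plane R -> R[i]) (nu M : R)
    (y : spacetime R) (A : set (plane R)) :
  measurable (A : set (measurableTypeR R * measurableTypeR R)) ->
  leb2 R A = M%:E -> 0 < M -> 0 <= nu ->
  (forall xi, A xi -> b (y, xi) = 1) ->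
  (forall xi, A xi -> 0 <= nu * Phi_hyp y xi <= 1) ->
  nu * cos 1 * Num.sqrt M <=
    ComplexField.Normc.normc (T_op (@Phi_hyp R) b nu (unit_indic M A) y).
Proof.
move=> mA mAM M0 nu0 b1 phase.
have s0 : 0 < Num.sqrt M by rewrite sqrtr_gt0.
have Re_le (z : R[i]) : complex.Re z <= ComplexField.Normc.normc z.
  case: z => u v /=; rewrite (le_trans (ler_norm u))// -sqrtr_sqr.
  by rewrite ler_sqrt ?lerDl ?addr_ge0 ?sqr_ge0.
apply: le_trans (Re_le _); rewrite /T_op /cintegral /= mul0r subr0 -mulrA.
apply: ler_wpM2l => //.
(* Off [A] the indicator kills the integrand; on [A] the amplitude [b] is 1, so only the cosine of
   the phase remains in the real part. *)
rewrite [leRHS](_ : _ = \int[leb2 R]_(xi in A)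
    ((Num.sqrt M)^-1 * cos (nu * Phi_hyp y xi))); last first.
  rewrite [RHS]Rintegral_mkcond; congr fine; apply: eq_integral => xi _.
  rewrite /unit_indic /= patchE indicE /=; have [/set_mem Axi|_] := boolP (xi \in A).
    by rewrite b1//= !mulr1 !mulr0 !subr0 mulrC.
  by rewrite mulr0; case: (_ * b _) => u v /=; rewrite !mulr0 subrr.
(* As [M / Num.sqrt M = Num.sqrt M], the lower bound is itself the integral of a constant, and the
   integrands can be compared pointwise. *)
have -> : cos 1 * Num.sqrt M =
    \int[leb2 R]_(xi in A) ((Num.sqrt M)^-1 * cos 1).
  rewrite Rintegral_cst// (_ : fine _ = M); last exact: (congr1 fine mAM).
  rewrite [X in _ * _ * X](_ : M = Num.sqrt M ^+ 2); last first.
    by rewrite sqr_sqrtr// ltW.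
  by field; rewrite gt_eqF.
have Aoo : (leb2 R A < +oo)%E by rewrite mAM ltry.
have mcos :
    measurable_fun A (fun xi => cos (nu * Phi_hyp y xi) : measurableTypeR R).
  apply: measurable_funTS; apply: measurableT_comp.
    by apply: continuous_measurable_fun; exact: continuous_cos.
  by apply: measurable_funM => //; exact: measurable_Phi_hyp.
have intA (g : plane R -> R) :
    measurable_fun (A : set (measurableTypeR R * measurableTypeR R))
      (g : _ -> measurableTypeR R) ->
    (forall xi, `|g xi| <= 1) ->
    (leb2 R).-integrable A (EFin \o (fun xi => (Num.sqrt M)^-1 * g xi)).
  move=> mg g1; apply: measurable_bounded_integrable => //.
    by apply: measurable_funM.
  exists (Num.sqrt M)^-1; split; first exact: num_real.
  move=> x Mx xi _ /=; rewrite normrM (le_trans _ (ltW Mx))//.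
  have V0 : 0 <= (Num.sqrt M)^-1 by rewrite invr_ge0 ltW.
  by rewrite ger0_norm// ler_piMr.
apply: le_Rintegral => //.
- apply: (intA (cst (cos 1))); first exact: measurable_cst.
  by move=> xi; exact: cos_max.
- by apply: intA; [exact: mcos|move=> xi; exact: cos_max].
- move=> xi Axi; apply: ler_wpM2l; first by rewrite invr_ge0 ltW.
  by apply: cos1_le_cos; exact: phase.
Qed.

End lower_bounds.

(** * Areas of the hyperbolic region and the square, volume of the prism *)

Section regions.
Variable R : realType.
Local Open Scope classical_set_scope.

Lemma integral_invr (u v : R) : 0 < u -> u < v ->
  (\int[@lebesgue_measure R]_(x in `[u, v]) (x^-1)%:E = (ln v - ln u)%:E)%E.
Proof.
move=> u0 uv; rewrite EFinB; apply: continuous_FTC2 => //.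
- apply: continuous_in_subspaceT => x; rewrite inE/= in_itv/= => /andP[ux _].
  by apply: inv_continuous; rewrite gt_eqF// (lt_le_trans u0).
- split.
  + move=> x; rewrite in_itv/= => /andP[ux _].
    by have [] := is_derive1_ln (lt_trans u0 ux).
  + by apply: cvg_at_right_filter; exact: continuous_ln.
  + apply: cvg_at_left_filter; apply: continuous_ln.
    exact: lt_trans uv.
- move=> x; rewrite in_itv/= => /andP[ux _]; rewrite derive1E.
  by have := is_derive1_ln (lt_trans u0 ux) => /@derive_val.
Qed.

Lemma lebesgue_measure_segment (u v : R) : u <= v ->
  lebesgue_measure (`[u, v] : set (measurableTypeR R)) = (v - u)%:E.
Proof.
move=> uv; rewrite lebesgue_measure_itv/= lte_fin EFinB.
by case: ltgtP uv => // -> _; rewrite subee.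
Qed.

Definition hyp_region (u v r : R) : set (plane R) :=
  [set p | [/\ u <= p.1 <= v, 0 <= p.2 & p.1 * p.2 <= r]].

Lemma measurable_hyp_region (u v r : R) :
  measurable (hyp_region u v r : set (measurableTypeR R * measurableTypeR R)).
Proof.
have -> : hyp_region u v r =
    (`[u, v] `*` `[0, +oo[) `&` (fun p => p.1 * p.2) @^-1` `]-oo, r].
  apply/seteqP; split => -[x y] /=; rewrite !in_itv/= andbT.
    by move=> [].
  by move=> [[]].
apply: measurableI; first exact: measurableX.
rewrite -[X in measurable X]setTI.
by apply: (measurable_funM measurable_fst measurable_snd).
Qed.

(** The section over [x] in [[u, v]] is the segment [[0, r / x]], and it is empty for other [x];
    integrating its length produces the logarithm. *)
Lemma leb2_hyp_region (u v r : R) : 0 < u -> u < v -> 0 <= r ->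
  leb2 R (hyp_region u v r) = (r * (ln v - ln u))%:E.
Proof.
move=> u0 uv r0; rewrite /leb2 /product_measure1.
rewrite EFinM -integral_invr// -ge0_integralZl//; last 2 first.
- apply/measurable_EFinP; apply: subspace_continuous_measurable_fun => //.
  apply: continuous_in_subspaceT => x; rewrite inE/= in_itv/= => /andP[ux _].
  by apply: inv_continuous; rewrite gt_eqF// (lt_le_trans u0).
- move=> x /=; rewrite in_itv/= => /andP[ux _].
  by rewrite lee_fin invr_ge0 (le_trans (ltW u0)).
rewrite [RHS]integral_mkcond; apply: eq_integral => x _ /=.
rewrite patchE; case: ifPn => [|/negP nx].
  rewrite inE/= in_itv/= => /andP[ux xv].
  have x0 : 0 < x by exact: lt_le_trans ux.
  rewrite (_ : xsection _ _ = `[0, r / x]).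
    by rewrite lebesgue_measure_segment ?subr0// divr_ge0// ltW.
  apply/seteqP; split => y; rewrite /xsection/= inE/= in_itv/= /hyp_region/=.
    by move=> [_ -> xyr]; rewrite ler_pdivlMr// mulrC.
  by move=> /andP[y0]; rewrite ler_pdivlMr// mulrC ux xv.
rewrite (_ : xsection _ _ = set0) ?measure0//.
apply/seteqP; split => y //; rewrite /xsection/= inE/= => -[uxv _ _].
by apply: nx; rewrite inE/= in_itv/=.
Qed.

Lemma leb2_square (r : R) : 0 <= r ->
  leb2 R (`[0, r] `*` `[0, r]) = (r ^+ 2)%:E.
Proof.
move=> r0; have := lebesgue_measure_segment r0; rewrite subr0 => mr.
by rewrite /leb2 product_measure1E// EFinM; congr (_ * _)%E; exact: mr.
Qed.

Lemma leb3_prism (r : R) : 0 <= r ->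
  leb3 R (`[0, 1] `*` (`[0, r] `*` `[0, r])) = (r ^+ 2)%:E.
Proof.
move=> r0; rewrite /leb3 product_measure1E//; last exact: measurableX.
have := lebesgue_measure_segment (@ler01 R); rewrite subr0 => m1.
by rewrite -[RHS]mul1e; congr (_ * _)%E; [exact: m1|exact: leb2_square].
Qed.

End regions.

(** * Bounds on points and phases *)

Section phases.
Variable R : realType.

Lemma enorm_le (x : plane R) (a : R) :
  0 <= x.1 <= a -> 0 <= x.2 <= a -> enorm x <= 2 * a.
Proof.
move=> /andP[x0 xa] /andP[y0 ya].
rewrite -[leRHS]ger0_norm; last by lra.
rewrite -sqrtr_sqr ler_wsqrtr// /dot; nra.
Qed.

Lemma Phi_hyp_ge0 (s : R) (z xi : plane R) :
  0 <= s -> 0 <= z.1 -> 0 <= z.2 -> 0 <= xi.1 -> 0 <= xi.2 ->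
  0 <= Phi_hyp (s, z) xi.
Proof. by move=> *; rewrite /Phi_hyp /dot/= !addr_ge0 ?mulr_ge0. Qed.

(** Each linear term is at most [r * a]. The bilinear term has its own bound [t], because on the
    hyperbolic region it is controlled by [r] and not merely by [a ^ 2]. *)
Lemma Phi_hyp_le (s r a t : R) (z xi : plane R) :
  0 <= s <= 1 -> 0 <= z.1 <= r -> 0 <= z.2 <= r ->
  0 <= xi.1 <= a -> 0 <= xi.2 <= a -> xi.1 * xi.2 <= t ->
  Phi_hyp (s, z) xi <= 2 * (r * a) + t.
Proof.
move=> /andP[s0 s1] /andP[z10 z1r] /andP[z20 z2r] /andP[x0 xa] /andP[y0 ya] xyt.
have h1 : z.1 * xi.1 <= r * a by exact: ler_pM.
have h2 : z.2 * xi.2 <= r * a by exact: ler_pM.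
have h3 : s * (xi.1 * xi.2) <= t.
  by rewrite (le_trans _ xyt)// ler_piMl// mulr_ge0.
rewrite /Phi_hyp /dot/= -mulrA; lra.
Qed.

End phases.

(** * Choice of the constants and final estimate *)

Theorem proposition2p1 (R : realType) :
  exists c1 : R, 0 < c1 /\
  forall c0 : R, 0 < c0 -> c0 <= c1 ->
  forall b : spacetime R * plane R -> R[i],
    test_function b ->
    (forall (s : R) (z xi : plane R),
        0 <= s <= 1 -> enorm z <= c0 -> enorm xi <= c0 -> b ((s, z), xi) = 1) ->
  exists c : R, 0 < c /\
  exists lambda0 : R,
  forall lambda mu : R, lambda0 <= lambda -> mu = lambda ^+ 2 ->
  exists f g : plane R -> R[i],
    [/\ cmeasurable f /\ cmeasurable g,
        L2norm (leb2 R) f = 1%E,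
        L2norm (leb2 R) g = 1%E &
        ((c * (lambda `^ (1 / 2) * Num.sqrt (ln lambda)))%:E <=
         L2norm (leb3 R)
           (fun y => (T_op (@Phi_hyp R) b lambda f y *
                      T_op (@Phi_hyp R) b mu g y)%R))%E].
Proof.
(* [c0 <= 1] gives [a <= 1 / 2], which yields the final phase bounds [2 * a ^ 2 + a <= 1] and
   [3 * a ^ 2 <= 1]. *)
exists 1; split=> // c0 c00 c01 b _ b1.
pose a := c0 / 2; have a0 : 0 < a by rewrite /a; lra.
have a12 : a <= 1 / 2 by rewrite /a; lra.
have c0E : c0 = 2 * a by rewrite /a; field.
pose k : R := cos 1; have k0 : 0 < k by exact: cos1_gt0.
have sa0 : 0 < Num.sqrt (a / 2) by rewrite sqrtr_gt0; lra.
(* [k ^ 2] comes from the two cosines, [a ^ 2] from [(l * r) ^ 2], and [Num.sqrt (a / 2)] from the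
   area bound [M >= r * ln l / 2]. *)
exists (k ^+ 2 * a ^+ 2 * Num.sqrt (a / 2)); split.
  by rewrite !mulr_gt0// exprn_gt0.
exists (a ^- 2) => l mu al ->.
have la2 : 1 <= l * a ^+ 2.
  by move: al; rewrite -[a ^- 2]div1r ler_pdivrMr ?exprn_gt0.
have l0 : 0 < l.
  by rewrite (lt_le_trans _ al)// invr_gt0 exprn_gt0.
have a14 : a ^+ 2 <= 1 / 4 by nra.
have l4 : 4 <= l by nra.
pose r := a / l; have r0 : 0 < r by rewrite divr_gt0.
have lr : l * r = a by rewrite /r; field; rewrite gt_eqF.
have lVa : l^-1 < a.
  by rewrite -[l^-1]div1r ltr_pdivrMr//; nra.
have lV0 : 0 < l^-1 by rewrite invr_gt0.
(* Since [l * r = a], the hyperbola has height [a] at the cutoff [l^-1]; thus [E] lies in the square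
   of side [a]. *)
pose E := hyp_region l^-1 a r.
pose Q : set (plane R) := (`[0, r] `*` `[0, r])%classic.
pose M := r * (ln a - ln l^-1).
(* The threshold gives [l <= (a * l) ^ 2], so [ln (a * l)] keeps half of [ln l]. *)
have lnl : ln l <= 2 * (ln a - ln l^-1).
  rewrite lnV ?posrE// opprK -lnM ?posrE// mulr_natl -lnXn ?mulr_gt0//.
  by rewrite ler_ln ?posrE ?exprn_gt0 ?mulr_gt0//; nra.
have lnl0 : 0 < ln l by rewrite ln_gt0//; lra.
have M0 : 0 < M by rewrite mulr_gt0//; lra.
have mE := measurable_hyp_region l^-1 a r.
have mQ : measurable (Q : set (measurableTypeR R * measurableTypeR R)).
  exact: measurableX.
have EM : leb2 R E = M%:E by apply: leb2_hyp_region => //; exact: ltW.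
have QM : leb2 R Q = (r ^+ 2)%:E by apply: leb2_square; exact: ltW.
have rle : r <= a by nra.
have bE (s : R) (z xi : plane R) : 0 <= s <= 1 ->
    0 <= z.1 <= r -> 0 <= z.2 <= r -> 0 <= xi.1 <= a -> 0 <= xi.2 <= a ->
    b ((s, z), xi) = 1.
  move=> s01 /andP[z0 zr] /andP[z0' zr'] xa xa'.
  by apply: b1 => //; rewrite c0E; apply: enorm_le => //;
    rewrite ?z0 ?z0' (le_trans _ rle).
have memE (xi : plane R) :
    E xi -> [/\ 0 <= xi.1 <= a, 0 <= xi.2 <= a & xi.1 * xi.2 <= r].
  case=> /andP[x1 x2] y0 xy; split=> //.
    by rewrite x2 (le_trans (ltW lV0)).
  rewrite y0/= -(ler_pM2l lV0) [leRHS]mulrC.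
  by rewrite (le_trans _ xy)// ler_wpM2r.
have memQ (xi : plane R) : Q xi -> 0 <= xi.1 <= r /\ 0 <= xi.2 <= r.
  by move=> [] /=; rewrite !in_itv.
exists (unit_indic M E), (unit_indic (r ^+ 2) Q); split.
- by split; apply: cmeasurable_unit_indic.
- exact: L2norm_unit_indic.
- by apply: L2norm_unit_indic => //; rewrite exprn_gt0.
pose W := (`[0, 1] `*` Q)%classic : set (spacetime R).
have mW : measurable (W : set
    (measurableTypeR R * (measurableTypeR R * measurableTypeR R))).
  exact: measurableX.
have WM : leb3 R W = (r ^+ 2)%:E by apply: leb3_prism; exact: ltW.
(* Product of the two pointwise bounds on the prism; the last [r] is the root of the area of [Q]. *)
pose K := (l * k * Num.sqrt M) * (l ^+ 2 * k * r).
have K0 : 0 <= K by rewrite !mulr_ge0 ?sqrtr_ge0// ltW.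
apply: le_trans (L2norm_ge_cst_on mW WM K0 _).
  rewrite lee_fin sqrtr_sqr (ger0_norm (ltW r0)).
  have -> : K * r = k ^+ 2 * a ^+ 2 * (l * Num.sqrt M).
    by rewrite /K -lr; ring.
  rewrite -mulrA ler_pM2l ?mulr_gt0 ?exprn_gt0//.
  rewrite div1r powR12_sqrt ?(ltW l0)//.
  (* With [l = Num.sqrt (l ^ 2)] each side becomes a single root, leaving
     [a / 2 * (l * ln l) <= l ^ 2 * M]. *)
  rewrite -[X in _ <= X * _](ger0_norm (ltW l0)) -[X in _ <= X * _]sqrtr_sqr.
  rewrite -!sqrtrM ?sqr_ge0 ?(ltW l0)//; last by lra.
  rewrite ler_wsqrtr// /M expr2 -[leRHS]mulrA (mulrA l r) lr.
  rewrite (_ : a / 2 * (l * ln l) = l * (a * (ln l / 2))); last by field.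
  by rewrite !ler_pM2l//; lra.
move=> [s z] [] s01 /memQ; move: s01; rewrite [X in X -> _]/= in_itv.
move=> s01 [z1 z2].
have [s0 s1] := andP s01.
have [[z10 z1r] [z20 z2r]] := (andP z1, andP z2).
rewrite ComplexField.Normc.normcM; apply: ler_pM.
- by rewrite !mulr_ge0 ?sqrtr_ge0// ltW.
- by rewrite !mulr_ge0 ?exprn_ge0// ltW.
- apply: T_op_unit_indic_ge => //; first exact: ltW.
    by move=> xi /memE[x1 x2 _]; exact: bE.
  move=> xi /memE[x1 x2 xy]; have [[x10 x1a] [x20 x2a]] := (andP x1, andP x2).
  rewrite mulr_ge0 ?Phi_hyp_ge0 ?(ltW l0)//=.
  have := Phi_hyp_le s01 z1 z2 x1 x2 xy.
  rewrite -(ler_pM2l l0) => /le_trans; apply.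
  have -> : l * (2 * (r * a) + r) = 2 * a ^+ 2 + a by rewrite -lr; ring.
  nra.
- rewrite -[X in _ * X](ger0_norm (ltW r0)) -sqrtr_sqr.
  apply: T_op_unit_indic_ge => //.
  + by rewrite exprn_gt0.
  + by rewrite exprn_ge0// ltW.
  + move=> xi /memQ[/andP[x10 x1r] /andP[x20 x2r]].
    by apply: bE; rewrite ?x10 ?x20 ?(le_trans _ rle).
  + move=> xi /memQ[x1 x2]; have [[x10 x1r] [x20 x2r]] := (andP x1, andP x2).
    rewrite mulr_ge0 ?Phi_hyp_ge0 ?exprn_ge0 ?(ltW l0)//=.
    have xy : xi.1 * xi.2 <= r ^+ 2 by rewrite expr2 ler_pM.
    have := Phi_hyp_le s01 z1 z2 x1 x2 xy.
    rewrite -(ler_pM2l (exprn_gt0 2 l0)) => /le_trans; apply.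
    (* On [Q] both variables have size [r = a / l], so even the larger frequency [l ^ 2] leaves a
       bounded phase. *)
    have -> : l ^+ 2 * (2 * (r * r) + r ^+ 2) = 3 * a ^+ 2 by rewrite -lr; ring.
    nra.
Qed.
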